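(* Let $R_1,R_2$ be commutative rings with identity and, for $i=1,2$, let $M_i$ be an $R_i$-module and $S_i$ a multiplicatively closed subset of $R_i$. Let $R=R_1\times R_2$, let $M=M_1\times M_2$ be regarded as an $R$-module, and let $S=S_1\times S_2$, a multiplicatively closed subset of $R$. Let $P=P_1\times P_2$ be a submodule of $M$ (with $P_i$ a submodule of $M_i$). Then the following are equivalent: (a) $P$ is an $S$-primary submodule of $M$. (b) Either $P_1$ is an $S_1$-primary submodule of $M_1$ and $(P_2:_{R_2}M_2)\cap S_2\neq\emptyset$, or $P_2$ is an $S_2$-primary submodule of $M_2$ and $(P_1:_{R_1}M_1)\cap S_1\neq\emptyset$.
   Context: All rings are commutative with identity and all modules are unital. A multiplicatively closed subset $S$ of a ring $R$ is a non-empty subset with $0\notin S$, $1\in S$, and $ss'\in S$ for all $s,s'\in S$. $(P:_R M)=\{r\in R : rM\subseteq P\}$, and $\sqrt{I}$ is the radical of an ideal $I$. A submodule $P$ of an $R$-module $M$ with $(P:_R M)\cap S=\emptyset$ is called $S$-primary if there exists $s\in S$ such that whenever $rm\in P$ with $r\in R$, $m\in M$, then $sr\in\sqrt{(P:_R M)}$ or $sm\in P$. The ring $R_1\times R_2$ acts on $M_1\times M_2$ componentwise. *)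

(* Defs.v *)
From HB Require Import structures.
From mathcomp Require Import all_boot all_algebra.
From mathcomp Require Import boolp classical_sets.

Set Implicit Arguments.
Unset Strict Implicit.
Unset Printing Implicit Defensive.

Import GRing.Theory.
Local Open Scope ring_scope.
Local Open Scope classical_set_scope.

Definition mult_closed (R : comPzRingType) (S : set R) : Prop :=
  [/\ ~ S 0, S 1 & forall s s', S s -> S s' -> S (s * s')].

Definition submodule (R : comPzRingType) (M : lmodType R) (P : set M) : Prop :=
  GRing.submod_closed [in P].

Definition colon (R : comPzRingType) (M : lmodType R) (P : set M) : set R :=
  [set r | forall m : M, P (r *: m)].

Definition radical (R : comPzRingType) (I : set R) : set R :=
  [set r | exists2 n, (0 < n)%N & I (r ^+ n)].

Definition S_primary (R : comPzRingType) (S : set R) (M : lmodType R)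
    (P : set M) : Prop :=
  [/\ submodule P,
      colon P `&` S = set0 &
      exists2 s, S s &
        forall (r : R) (m : M), P (r *: m) ->
          radical (colon P) (s * r) \/ P (s *: m)].

(* The pair type [M1 * M2] is a library module only over a common scalar ring;
   this alias carries the componentwise action of [R1 * R2] instead. *)
Definition prod_mod (R1 R2 : comPzRingType) (M1 : lmodType R1)
  (M2 : lmodType R2) : Type := (M1 * M2)%type.

Section ProdMod.
Variables (R1 R2 : comPzRingType) (M1 : lmodType R1) (M2 : lmodType R2).

HB.instance Definition _ :=
  GRing.Zmodule.copy (prod_mod M1 M2) (M1 * M2)%type.

Definition prod_scale (r : R1 * R2) (m : prod_mod M1 M2) : prod_mod M1 M2 :=
  (r.1 *: m.1, r.2 *: m.2).

Fact prod_scaleA a b v :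
  prod_scale a (prod_scale b v) = prod_scale (a * b) v.
Proof. by rewrite /prod_scale /= !scalerA. Qed.

Fact prod_scale1 : left_id 1 prod_scale.
Proof. by case=> v1 v2; rewrite /prod_scale /= !scale1r. Qed.

Fact prod_scaleDr : right_distributive prod_scale +%R.
Proof. by move=> a u v; rewrite /prod_scale /= !scalerDr. Qed.

Fact prod_scaleDl v : {morph prod_scale^~ v : a b / a + b}.
Proof. by move=> a b; rewrite /prod_scale /= !scalerDl. Qed.

HB.instance Definition _ :=
  GRing.Zmodule_isLmodule.Build (R1 * R2)%type (prod_mod M1 M2)
    prod_scaleA prod_scale1 prod_scaleDr prod_scaleDl.

Lemma prod_mult_closed (S1 : set R1) (S2 : set R2) :
  mult_closed S1 -> mult_closed S2 ->
  mult_closed (S1 `*` S2 : set (R1 * R2)%type).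
Proof.
move=> [n1 i1 m1] [n2 i2 m2]; split => /=; first by case.
  by split.
by move=> s t [? ?] [? ?]; split; [apply: m1|apply: m2].
Qed.

Lemma prod_submodule (P1 : set M1) (P2 : set M2) :
  submodule P1 -> submodule P2 ->
  submodule (P1 `*` P2 : set (prod_mod M1 M2)).
Proof.
move=> [z1 c1] [z2 c2]; split.
  by rewrite inE; split; rewrite -in_setE.
move=> a u v; rewrite !inE => -[u1 u2] [v1 v2].
split; rewrite -in_setE; [apply: c1|apply: c2]; by rewrite inE.
Qed.

End ProdMod.

(* Main.v *)
Require Import Defs.
From mathcomp Require Import all_boot all_algebra.
From mathcomp Require Import boolp classical_sets.

Import GRing.Theory.
Local Open Scope ring_scope.
Local Open Scope classical_set_scope.

(** The colon of [P1 x P2] is the product of the colons.  Since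
    [(1, 0) (0, m2) = 0] lies in [P1 x P2], any witness [(s1, s2)] of
    primariness satisfies [s1 ^ n \in colon P1] for some [n], or
    [s2 M2 <= P2]: one of the two colons meets its multiplicative set.
    They cannot both do so, and the component whose colon avoids its
    multiplicative set inherits primariness.  Conversely, if [t] lies in both
    [colon P2] and [S2], then [(s1, t)] is a witness for the product whenever
    [s1] is one for [P1]. *)

Lemma pair_expr (R1 R2 : pzRingType) (r : R1 * R2) (n : nat) :
  r ^+ n = (r.1 ^+ n, r.2 ^+ n).
Proof. by elim: n => [|n IHn]; rewrite ?expr0 // !exprS IHn. Qed.

Lemma mult_closed_expr (R : comPzRingType) (S : set R) (s : R) (n : nat) :
  mult_closed S -> S s -> S (s ^+ n).
Proof.
move=> [_ S_1 S_M] Ss; elim: n => [|n IHn]; first by rewrite expr0.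
by rewrite exprS; apply: S_M.
Qed.

Lemma submodule0 (R : comPzRingType) (M : lmodType R) (P : set M) :
  submodule P -> P 0.
Proof. by case; rewrite inE. Qed.

(** A positive power keeps a factor [t] that can be made to act last, and [t] sends every vector
    into [P]. *)
Lemma colon_exprM (R : comPzRingType) (M : lmodType R) (P : set M) (t r : R)
    (n : nat) :
  (0 < n)%N -> colon P t -> colon P ((t * r) ^+ n).
Proof.
case: n => // n _ Pt m.
by rewrite exprS -mulrA -scalerA; apply: Pt.
Qed.

Lemma colon_prod (R1 R2 : comPzRingType) (M1 : lmodType R1) (M2 : lmodType R2)
    (P1 : set M1) (P2 : set M2) :
  colon (P1 `*` P2 : set (prod_mod M1 M2)) = colon P1 `*` colon P2.
Proof.
apply/seteqP; split=> [r Pr | r [Pr1 Pr2] m]; last first.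
  by split; [apply: Pr1 | apply: Pr2].
(* Vectors supported on one component isolate each colon. *)
by split=> m; [case: (Pr (m, 0)) | case: (Pr (0, m))].
Qed.

(** This symmetry lets the other lemmas treat only the case where primariness sits on the first
    component. *)
Lemma S_primary_swap (R1 R2 : comPzRingType) (M1 : lmodType R1)
    (M2 : lmodType R2) (S1 : set R1) (S2 : set R2) (P1 : set M1)
    (P2 : set M2) :
  submodule P1 -> submodule P2 ->
  S_primary (S1 `*` S2) (P1 `*` P2 : set (prod_mod M1 M2)) ->
  S_primary (S2 `*` S1) (P2 `*` P1 : set (prod_mod M2 M1)).
Proof.
move=> P1_sub P2_sub [_ /seteqP[disj _] [s [Ss1 Ss2] sP]].
rewrite colon_prod in disj sP.
split; first exact: prod_submodule.
  rewrite colon_prod -subset0 => r [[Pr2 Pr1] [Sr2 Sr1]].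
  exact: (disj (r.2, r.1)).
exists (s.2, s.1); first by split.
move=> r m [Prm2 Prm1]; rewrite colon_prod.
have [[n n_gt0]|[sm1 sm2]] := sP (r.2, r.1) (m.2, m.1) (conj Prm1 Prm2).
  rewrite pair_expr => -[rn1 rn2]; left; exists n => //.
  by rewrite pair_expr; split.
by right; split.
Qed.

Lemma S_primary_prod (R1 R2 : comPzRingType) (M1 : lmodType R1)
    (M2 : lmodType R2) (S1 : set R1) (S2 : set R2) (P1 : set M1)
    (P2 : set M2) :
  submodule P2 -> S_primary S1 P1 -> colon P2 `&` S2 !=set0 ->
  S_primary (S1 `*` S2) (P1 `*` P2 : set (prod_mod M1 M2)).
Proof.
move=> P2_sub [P1_sub /seteqP[disj _] [s Ss sP]] [t [Pt St]].
split; first exact: prod_submodule.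
  rewrite colon_prod -subset0 => r [[Pr1 _] [Sr1 _]].
  exact: (disj r.1).
exists (s, t) => // r m [Prm1 _]; rewrite colon_prod.
have [[n n_gt0 Pn]|Psm] := sP _ _ Prm1; [left | right].
  by exists n => //; rewrite pair_expr; split=> //; apply: colon_exprM.
by split=> //; apply: Pt.
Qed.

Lemma S_primary_prod_fst (R1 R2 : comPzRingType) (M1 : lmodType R1)
    (M2 : lmodType R2) (S1 : set R1) (S2 : set R2) (P1 : set M1)
    (P2 : set M2) :
  submodule P1 -> submodule P2 ->
  S_primary (S1 `*` S2) (P1 `*` P2 : set (prod_mod M1 M2)) ->
  colon P2 `&` S2 !=set0 -> S_primary S1 P1.
Proof.
move=> P1_sub P2_sub [_ /seteqP[disj _] [s [Ss1 _] sP]] [t [Pt St]].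
rewrite colon_prod in disj sP.
split=> //.
  (* Pairing with [t] lifts a common element of [colon P1] and [S1] to one forbidden by [disj]. *)
  by rewrite -subset0 => r [Pr Sr]; apply: (disj (r, t)).
exists s.1 => // r m Prm.
(* Padding by zero makes the second coordinate of the hypothesis [P2 0], so only [r *: m]
   matters. *)
have [|[n n_gt0]|[Psm _]] := sP (r, 0) (m, 0); last by right.
  by split=> //=; rewrite scaler0; apply: submodule0.
by rewrite pair_expr => -[Pn _]; left; exists n.
Qed.

Lemma S_primary_prod_colon (R1 R2 : comPzRingType) (M1 : lmodType R1)
    (M2 : lmodType R2) (S1 : set R1) (S2 : set R2) (P1 : set M1)
    (P2 : set M2) :
  mult_closed S1 -> submodule P1 -> submodule P2 ->
  S_primary (S1 `*` S2) (P1 `*` P2 : set (prod_mod M1 M2)) ->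
  colon P1 `&` S1 !=set0 \/ colon P2 `&` S2 !=set0.
Proof.
move=> S1_mult P1_sub P2_sub [_ _ [s [Ss1 Ss2] sP]].
rewrite colon_prod in sP.
have [meet1|avoid1] := pselect (colon P1 `&` S1 !=set0); [by left | right].
exists s.2; split=> // m.
have [|[n _]|[_ //]] := sP (1, 0) (0, m).
  by split=> /=; rewrite ?scaler0 ?scale0r; apply: submodule0.
(* The radical alternative puts a power of [s.1] in [colon P1], and that power stays in [S1]. *)
rewrite pair_expr /= mulr1 => -[Pn _]; case: avoid1.
by exists (s.1 ^+ n); split=> //; apply: mult_closed_expr.
Qed.

Theorem theorem2p20 (R1 R2 : comPzRingType)
    (M1 : lmodType R1) (M2 : lmodType R2)
    (S1 : set R1) (S2 : set R2)
    (S1_mult : mult_closed S1) (S2_mult : mult_closed S2)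
    (P1 : set M1) (P2 : set M2)
    (P1_sub : submodule P1) (P2_sub : submodule P2) :
  S_primary (S1 `*` S2) (P1 `*` P2 : set (prod_mod M1 M2)) <->
  (S_primary S1 P1 /\ colon P2 `&` S2 !=set0) \/
  (S_primary S2 P2 /\ colon P1 `&` S1 !=set0).
Proof.
split=> [primP | [[prim1 meet2] | [prim2 meet1]]].
- have [||||meet1|meet2] := S_primary_prod_colon _ _ _ _ S1 S2 P1 P2 => //.
    (* Applied to [P2 * P1], with [meet1] as the condition on the complementary factor. *)
    right; split=> //; apply: S_primary_prod_fst (meet1) => //.
    exact: S_primary_swap.
  by left; split=> //; apply: S_primary_prod_fst primP meet2.
- exact: S_primary_prod.
- by apply: S_primary_swap => //; apply: S_primary_prod.
Qed.
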